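(* Let $\theta$ be a positive real number and $n_0$ a positive integer such that $|u|_2/|u|>\theta$ for every smooth word $u$ with $|u|>n_0$. Then there are positive constants $c_1,c_2$ such that \[c_1\cdot n^{\frac{\log 3}{\log(2-\theta)}}\le \gamma(n)\le c_2\cdot n^{\frac{\log 3}{\log(1+\theta)}}\] for every positive integer $n$.
   Context: Let $\Sigma=\{1,2\}$ and $\Sigma^*$ the set of finite words over $\Sigma$, with empty word $\varepsilon$. For a word $w$, $|w|$ is its length and $|w|_i$ the number of occurrences of the letter $i$ in $w$. A run of a word is a maximal factor of consecutive identical letters. A finite word $w$ is differentiable if neither $111$ nor $222$ occurs in it; its derivative $D(w)$ is the word whose $j$-th symbol is the length of the $j$-th run of $w$, where the first run and/or the last run of $w$ is discarded if it has length one. A word is smooth ($C^\infty$) if it is arbitrarily often differentiable, i.e. $D^j(w)$ is defined and differentiable for all $j\ge0$. $\gamma(n)$ denotes the number of smooth words of length $n$ over $\Sigma$. *)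

(* Defs.v *)
From mathcomp Require Import all_boot all_order all_algebra.
From mathcomp Require Import all_classical all_reals all_analysis.

Set Implicit Arguments.
Unset Strict Implicit.
Unset Printing Implicit Defensive.

Local Open Scope nat_scope.

(* Words are sequences of naturals, since run lengths are again letters; the
   alphabet constraint is part of [differentiable]. *)
Definition alphabet : seq nat := [:: 1; 2].

Definition over_alphabet (w : seq nat) : bool := all (mem alphabet) w.

Fixpoint runs (w : seq nat) : seq (seq nat) :=
  if w is x :: w' then
    match runs w' with
    | (y :: r) :: rs =>
        if x == y then (x :: y :: r) :: rs else [:: x] :: (y :: r) :: rs
    | rs => [:: x] :: rs
    end
  else [::].

Definition discard_first1 (s : seq nat) : seq nat :=
  if s is 1 :: s' then s' else s.

Definition discard_last1 (s : seq nat) : seq nat :=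
  rev (discard_first1 (rev s)).

(* Total on [seq nat], but meaningful only on differentiable words. In
   particular [derivative [:: x] = [::]]: a single run of length one is both
   the first and the last run, and is discarded once. *)
Definition derivative (w : seq nat) : seq nat :=
  discard_last1 (discard_first1 (map size (runs w))).

Definition differentiable (w : seq nat) : bool :=
  [&& over_alphabet w, ~~ infix [:: 1; 1; 1] w & ~~ infix [:: 2; 2; 2] w].

(* That D^j(w) is defined amounts to D^i(w) being differentiable for all
   i < j, which is covered by the quantification over j. *)
Definition smooth (w : seq nat) : Prop :=
  forall j : nat, differentiable (iter j derivative w).

(* [seq_sub alphabet] is the finite type of letters. *)
Definition gamma (n : nat) : nat :=
  #|[set w : n.-tuple (seq_sub alphabet) | `[< smooth (map val w) >]]|.

(* Main.v *)
Require Import Defs.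
From mathcomp Require Import all_boot all_order all_algebra.
From mathcomp Require Import all_classical all_reals all_analysis.
From mathcomp Require Import zify ring lra.

(* Call a word w left doubly extendable (LDE) if 1w and 2w are both smooth.
   Every smooth word is left extendable, so gamma(n) - 1 is the number of LDE
   words of length < n. A nonempty w is LDE iff its first run has length one and
   D(w) is LDE. A nonempty LDE word u has two or four LDE primitives, according
   to whether its last letter is 1 or 2; since swapping the letters does not
   change the derivative, both last letters are equally frequent, and there are
   exactly 2 * 3^K - 1 LDE words w with D^K(w) empty. On the other hand
   |D(w)| + |D(w)|_2 <= |w| <= |D(w)| + |D(w)|_2 + 2, so by the density
   hypothesis (applied also to the swapped word) a derivation divides lengths by
   a factor between 1 + theta and 2 - theta, up to bounded errors. Hence the LDE
   words of length < n are those of height about log n, to a base between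
   1 + theta and 2 - theta. *)

Set Implicit Arguments.
Unset Strict Implicit.
Unset Printing Implicit Defensive.

Import Order.TTheory GRing.Theory Num.Theory.
Local Open Scope nat_scope.

(** * Run lengths of a word *)

Definition run_lengths (w : seq nat) : seq nat := map size (runs w).

Lemma run_lengths_cons (x a : nat) (w : seq nat) :
  run_lengths [:: x, a & w] =
    if x == a then (head 0 (run_lengths (a :: w))).+1 :: behead (run_lengths (a :: w))
    else 1 :: run_lengths (a :: w).
Proof.
rewrite /run_lengths /=; case: (runs w) => [|[|y r] rs] /=.
- by case: eqP.
- by case: eqP.
- by case: (a == y) => /=; case: (x == a).
Qed.

Lemma run_lengths_gt0 (w : seq nat) : all (ltn 0) (run_lengths w).
Proof.
elim: w => [//|x [//|a w] IH]; rewrite run_lengths_cons.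
by move: IH; case: (run_lengths _) => [|k l]; case: ifP => //= _ /andP[].
Qed.

Lemma run_lengths_nil (w : seq nat) : (run_lengths w == [::]) = (w == [::]).
Proof. by case: w => [//|x [//|a w]]; rewrite run_lengths_cons; case: ifP. Qed.

Lemma sumn_run_lengths (w : seq nat) : sumn (run_lengths w) = size w.
Proof.
elim: w => [//|x [//|a w] IH]; rewrite run_lengths_cons.
have := run_lengths_nil (a :: w); move: IH.
by case: (run_lengths _) => [//|k l]; case: ifP => //= _ <- _.
Qed.

Lemma run_lengths_map (f : nat -> nat) (w : seq nat) :
  injective f -> run_lengths (map f w) = run_lengths w.
Proof.
move=> f_inj; elim: w => [//|x [//|a w] IH].
by rewrite (run_lengths_cons x a w) -IH !map_cons run_lengths_cons (inj_eq f_inj).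
Qed.

(** * Exchange of the letters, and recovery of a word from its run lengths *)

Definition swap (x : nat) : nat := if x == 1 then 2 else if x == 2 then 1 else x.

Lemma swapK : involutive swap.
Proof. by case=> [|[|[|x]]]. Qed.

Lemma over_alphabet_swap (w : seq nat) : over_alphabet (map swap w) = over_alphabet w.
Proof. by rewrite /over_alphabet all_map; apply: eq_all; case=> [|[|[|x]]]. Qed.

(** Runs are nonempty, so excluding cubes of letters leaves only the lengths 1 and 2. In this form
    the test depends on the run lengths, from which the derivative is computed. *)
Lemma differentiableE (w : seq nat) :
  Defs.differentiable w = over_alphabet w && over_alphabet (run_lengths w).
Proof.
rewrite /Defs.differentiable; case wA: (over_alphabet w) => //=.
elim: w wA => [//|x [|a [|b w]] IH].
- by case: x IH => [|[|[|x]]].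
- by case: x IH => [|[|[|x]]] //; case: a => [|[|[|x]]].
move=> /[dup] /andP[_ wA]; move/IH: wA => {IH}; rewrite !run_lengths_cons.
have := run_lengths_nil (b :: w).
case: (run_lengths _) (run_lengths_gt0 (b :: w)) => [//|k l] k0 _.
case: x => [|[|[|x]]] //; case: a => [|[|[|a]]] //; case: b k0 => [|[|[|b]]] //= k0 h wA;
  rewrite ?h // prefix0s ?andbF //=; by case: k k0 {h}.
Qed.

(** Inverse of [run_lengths] once the first letter [x] is given, since consecutive runs over two
    letters alternate. *)
Fixpoint word_of_runs (x : nat) (l : seq nat) : seq nat :=
  if l is k :: l' then nseq k x ++ word_of_runs (swap x) l' else [::].

Lemma over_alphabet_word_of_runs (x : nat) (l : seq nat) :
  x \in alphabet -> over_alphabet (word_of_runs x l).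
Proof.
elim: l x => //= k l IH x xA; rewrite /over_alphabet all_cat all_nseq.
apply/andP; split; first by apply/orP; right.
by apply: IH; case: x xA => [|[|[|x]]].
Qed.

Lemma run_lengths_word_of_runs (x : nat) (l : seq nat) : x \in alphabet ->
  all (ltn 0) l -> run_lengths (word_of_runs x l) = l.
Proof.
elim: l x => //= k l IH x xA /andP[k_gt0 l_gt0].
have sxA : swap x \in alphabet by case: x xA => [|[|[|x]]].
have xs : (x == swap x) = false by case: x xA sxA => [|[|[|x]]].
have {IH} := IH _ sxA l_gt0.
case: k k_gt0 => // k _; elim: k => [|k IHk] /=.
  case: l l_gt0 => [//|[//|j] l] _.
  by rewrite /= run_lengths_cons /= xs => ->.
by move=> /IHk {IHk}; rewrite /= run_lengths_cons eqxx => ->.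
Qed.

Lemma word_of_runs_run_lengths (w : seq nat) : over_alphabet w ->
  word_of_runs (head 1 w) (run_lengths w) = w.
Proof.
elim: w => [//|x [//|a w] IH] /andP[xA wA]; rewrite run_lengths_cons.
have := run_lengths_nil (a :: w); move/(_ wA) : IH.
case: (run_lengths _) => [//|k l] IH _; case: eqP => [->|/eqP xa] /=.
  by rewrite -[in RHS]IH.
rewrite -[in RHS]IH; congr (_ :: _); congr (word_of_runs _ (k :: l)); rewrite /=.
by case/andP: wA xA xa => + _ ; case: x => [|[|[|x]]] //; case: a {IH} => [|[|[|x]]].
Qed.

(** * Lengths under derivation *)

Lemma sumn_discard_first1 (s : seq nat) :
  sumn (discard_first1 s) <= sumn s <= (sumn (discard_first1 s)).+1.
Proof. by case: s => [|[|[|k]] s] //=; rewrite ?leqnn ?leqnSn ?leq_addl //= ltnS. Qed.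

Lemma sumn_discard_last1 (s : seq nat) :
  sumn (discard_last1 s) <= sumn s <= (sumn (discard_last1 s)).+1.
Proof. by rewrite /discard_last1 sumn_rev -(sumn_rev s) sumn_discard_first1. Qed.

Lemma size_discard_first1 (s : seq nat) : size (discard_first1 s) <= size s.
Proof. by case: s => [|[|[|k]] s] //=. Qed.

Lemma size_discard_last1 (s : seq nat) : size (discard_last1 s) <= size s.
Proof. by rewrite /discard_last1 size_rev -(size_rev s) size_discard_first1. Qed.

Lemma discard_last1_rcons (s : seq nat) (x : nat) :
  discard_last1 (rcons s x) = if x == 1 then s else rcons s x.
Proof.
by rewrite /discard_last1 rev_rcons; case: x => [|[|x]] /=; rewrite ?rev_cons revK.
Qed.

Lemma discard_last1_cons (x : nat) (s : seq nat) : s != [::] ->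
  discard_last1 (x :: s) = x :: discard_last1 s.
Proof.
case/lastP: s => // s z _; rewrite -rcons_cons !discard_last1_rcons.
by case: ifP.
Qed.

Lemma derivativeE (w : seq nat) :
  derivative w = discard_last1 (discard_first1 (run_lengths w)).
Proof. by []. Qed.

Lemma sumn_derivative (w : seq nat) :
  sumn (derivative w) <= size w <= (sumn (derivative w)).+2.
Proof.
rewrite derivativeE -sumn_run_lengths.
have /andP[h1 h2] := sumn_discard_first1 (run_lengths w).
have /andP[h3 h4] := sumn_discard_last1 (discard_first1 (run_lengths w)).
by rewrite (leq_trans h3 h1) (leq_trans h2).
Qed.

(** There are at most as many runs as letters. If the first run has length one it is discarded;
    otherwise the runs are already strictly fewer. This is the measure for inductions along
    derivation. *)
Lemma size_derivative (w : seq nat) : w != [::] -> size (derivative w) < size w.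
Proof.
rewrite -run_lengths_nil derivativeE -[size w]sumn_run_lengths => w0.
apply: leq_ltn_trans (size_discard_last1 _) _.
have size_sumn (s : seq nat) : all (ltn 0) s -> size s <= sumn s.
  by elim: s => //= k s IH /andP[k0 /IH]; lia.
case: (run_lengths w) (run_lengths_gt0 w) w0 => [//|[|[|k]] s] //= /size_sumn; lia.
Qed.

(** * Smoothness along derivation *)

Lemma smoothE (w : seq nat) :
  `[< Defs.smooth w >] = Defs.differentiable w && `[< Defs.smooth (derivative w) >].
Proof.
apply/asboolP/andP => [sw|[dw /asboolP sw] [|j]].
- split; first exact: (sw 0).
  by apply/asboolP => j; rewrite -iterSr; exact: (sw j.+1).
- exact: dw.
- by rewrite iterSr; apply: sw.
Qed.

Lemma smooth_nil : `[< Defs.smooth [::] >].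
Proof.
by apply/asboolP => j; have -> : iter j derivative [::] = [::] by elim: j => //= j ->.
Qed.

(** Run lengths ignore the names of the letters, so both words have the same derivative. *)
Lemma smooth_swap (w : seq nat) : `[< Defs.smooth (map swap w) >] = `[< Defs.smooth w >].
Proof.
rewrite smoothE (smoothE w) !differentiableE !derivativeE over_alphabet_swap.
by rewrite !run_lengths_map //; apply: inv_inj swapK.
Qed.

(** * Left extensions of smooth words *)

Definition left_doubly_extendable (w : seq nat) : bool :=
  `[< Defs.smooth (1 :: w) >] && `[< Defs.smooth (2 :: w) >].

Lemma over_alphabet_derivative (w : seq nat) :
  Defs.differentiable w -> over_alphabet (derivative w).
Proof.
rewrite differentiableE derivativeE => /andP[_].
have df (s : seq nat) : over_alphabet s -> over_alphabet (discard_first1 s).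
  by case: s => [|[|[|[|k]]] s].
have arev (s : seq nat) : over_alphabet (rev s) = over_alphabet s by exact: all_rev.
by move=> /df; rewrite -arev => /df; rewrite -arev.
Qed.

Lemma alphabetP (x : nat) : x \in alphabet -> x = 1 \/ x = 2.
Proof. by case: x => [|[|[|x]]]; [|left|right|]. Qed.

Lemma smooth1 (x : nat) : x \in alphabet -> `[< Defs.smooth [:: x] >].
Proof. by move=> /alphabetP[] ->; rewrite smoothE /= smooth_nil. Qed.

(** A first run of length one is discarded by derivation. Prefixing [x] either lengthens it to 2 or
    shields it by a new discarded run, so it reappears as the entry 2 or 1 in front of the old
    derivative. *)
Lemma smooth_cons_run1 (x a : nat) (w : seq nat) :
  Defs.differentiable (a :: w) -> w != [::] -> head 0 (run_lengths (a :: w)) = 1 ->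
  x \in alphabet ->
  `[< Defs.smooth (x :: a :: w) >] =
    `[< Defs.smooth ((x == a).+1 :: derivative (a :: w)) >].
Proof.
move=> dw w0 + xA; rewrite smoothE !derivativeE.
move: dw; rewrite !differentiableE => /andP[wA].
have -> : over_alphabet [:: x, a & w] by apply/andP.
rewrite run_lengths_cons; have := sumn_run_lengths (a :: w).
case: (run_lengths _) => [//|k l] + + k1; rewrite {k}[k]k1 /=.
move=> -[sl] lA.
(* A second run exists, so the discard at the end does not reach the new leading entry. *)
have l0 : l != [::] by case: l w w0 sl {lA wA} => [|? ?] [|? ?].
by case: (x == a); rewrite /= discard_last1_cons // lA.
Qed.

(** Prefixing [a] creates a cube; prefixing the other letter adds a run of length one, which is
    discarded and leaves the derivative unchanged. *)
Lemma smooth_cons_run2 (x a : nat) (w : seq nat) :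
  Defs.differentiable (a :: w) -> head 0 (run_lengths (a :: w)) = 2 ->
  x \in alphabet ->
  `[< Defs.smooth (x :: a :: w) >] = (x != a) && `[< Defs.smooth (a :: w) >].
Proof.
move=> dw + xA; rewrite (smoothE (a :: w)) dw smoothE !derivativeE.
move: dw; rewrite !differentiableE => /andP[wA].
have -> : over_alphabet [:: x, a & w] by apply/andP.
rewrite run_lengths_cons; case: (run_lengths _) => [//|k l] + k2.
by rewrite {k}[k]k2 => /= lA; case: (x == a); rewrite /= ?lA.
Qed.

(** One-letter words stand apart because their single run is both first and last, and is discarded
    only once. *)
Variant first_run_spec : seq nat -> Type :=
| FirstRunNil : first_run_spec [::]
| FirstRunSing a of a \in alphabet : first_run_spec [:: a]
| FirstRun1 a w of w != [::] & head 0 (run_lengths (a :: w)) = 1 :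
    first_run_spec (a :: w)
| FirstRun2 a w of head 0 (run_lengths (a :: w)) = 2 : first_run_spec (a :: w).

Lemma first_runP (w : seq nat) : Defs.differentiable w -> first_run_spec w.
Proof.
rewrite differentiableE; case: w => [|a [|b w]].
  by move=> _; constructor.
  by case/andP=> /andP[aA _] _; constructor.
have := run_lengths_nil [:: a, b & w].
move: (@FirstRun1 a (b :: w) isT) (@FirstRun2 a (b :: w)).
case: (run_lengths _) => [//|k l] /= h1 h2 _ /andP[_ /andP[kA _]].
by case: k kA h1 h2 => [|[|[|k]]] //= _ h1 h2; [apply: h1 | apply: h2].
Qed.

(** If the first run of [w] has length one, the derivative of [x :: w] is a letter in front of that
    of [w], and induction applies there. *)
Lemma smooth_behead (x : nat) (w : seq nat) :
  `[< Defs.smooth (x :: w) >] -> `[< Defs.smooth w >].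
Proof.
have [n] := ubnP (size w); elim: n x w => // n IH x w; rewrite ltnS => wn sxw.
have dxw : Defs.differentiable (x :: w) by move: sxw; rewrite smoothE => /andP[].
have dw : Defs.differentiable w.
  case/and3P: dxw; rewrite !infix_consl !negb_or => /andP[_ wA] /andP[_ w1] /andP[_ w2].
  by apply/and3P.
have xA : x \in alphabet by move: dxw; rewrite differentiableE => /andP[/andP[]].
have fw := first_runP dw; case: fw wn sxw dw {dxw} => [|a aA|a {}w w0 w1|a {}w w2] wn sxw dw.
- exact: smooth_nil.
- exact: smooth1.
- move: sxw; rewrite smooth_cons_run1 // => /IH IHw; rewrite smoothE dw; apply: IHw.
  by apply: leq_trans wn; apply: size_derivative.
- by move: sxw; rewrite smooth_cons_run2 // => /andP[].
Qed.

(** After a first run of length one, the two extensions of [w] correspond to those of its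
    derivative; after one of length two, the letter differing from the first always extends. *)
Lemma smooth_extendable (w : seq nat) : `[< Defs.smooth w >] ->
  `[< Defs.smooth (1 :: w) >] || `[< Defs.smooth (2 :: w) >].
Proof.
have [n] := ubnP (size w); elim: n w => // n IH w; rewrite ltnS => wn sw.
have [dw sDw] : Defs.differentiable w /\ `[< Defs.smooth (derivative w) >].
  by move: sw; rewrite smoothE => /andP[].
have wA : over_alphabet w by move: (dw); rewrite differentiableE => /andP[].
have fw := first_runP dw.
case: fw wn sw dw sDw wA => [|a aA|a {}w w0 w1|a {}w w2] wn sw dw sDw wA.
- by rewrite smooth1.
- by case/alphabetP: aA => ->; rewrite smoothE /= ?smooth_nil ?smooth1.
- rewrite !smooth_cons_run1 //.
  have/IH := leq_trans (@size_derivative (a :: w) isT) wn; move=> /(_ sDw).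
  by case/andP: wA => /alphabetP[] -> _ //=; rewrite orbC.
- rewrite !smooth_cons_run2 // sw !andbT.
  by case/andP: wA => /alphabetP[] ->.
Qed.

Lemma left_doubly_extendable_smooth (w : seq nat) :
  left_doubly_extendable w -> `[< Defs.smooth w >].
Proof. by case/andP => /smooth_behead. Qed.

Lemma left_doubly_extendable_nil : left_doubly_extendable [::].
Proof. by rewrite /left_doubly_extendable !smooth1. Qed.

(** With a first run of length one, prefixing 1 and 2 to [w] prefixes 1 and 2, in some order, to its
    derivative; with one of length two, only one letter extends. The default of [head] lets the
    empty word, which is LDE, pass the test. *)
Lemma left_doubly_extendableE (w : seq nat) : Defs.differentiable w ->
  left_doubly_extendable w =
    (head 1 (run_lengths w) == 1) && left_doubly_extendable (derivative w).
Proof.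
move=> dw.
have wA : over_alphabet w by move: (dw); rewrite differentiableE => /andP[].
have fw := first_runP dw; case: fw dw wA => [|a aA|a {}w w0 w1|a {}w w2] dw wA.
- by [].
- rewrite left_doubly_extendable_nil /left_doubly_extendable.
  case/alphabetP: aA => ->;
  by rewrite ![`[< Defs.smooth [:: _; _] >]]smoothE /= ?smooth_nil ?smooth1.
- have -> : head 1 (run_lengths (a :: w)) = 1.
    by move: w1; case: (run_lengths _).
  rewrite {1}/left_doubly_extendable !smooth_cons_run1 //.
  by case/andP: wA => /alphabetP[] -> _ //=; rewrite andbC.
- have -> : head 1 (run_lengths (a :: w)) = 2.
    by move: w2; case: (run_lengths _).
  rewrite {1}/left_doubly_extendable !smooth_cons_run2 //.
  by case/andP: wA => /alphabetP[] -> _ //=; rewrite andbF.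
Qed.

(** * Primitives of LDE words *)

Definition last_completions (u : seq nat) : seq (seq nat) :=
  if last 2 u == 1 then [:: rcons u 1] else [:: u; rcons u 1].

(** Only primitives with a first run of length one are wanted: their run lengths are 1 followed by a
    last completion of [u]. The empty word, a primitive of itself without first letter, is added
    apart. *)
Definition primitives (u : seq nat) : seq (seq nat) :=
  nseq (u == [::]) [::] ++
    [seq 1 :: word_of_runs 2 l | l <- last_completions u] ++
    [seq 2 :: word_of_runs 1 l | l <- last_completions u].

(** A word ending in 1 would lose that letter, hence is no completion of itself. The default 2 in
    [last 2 u] makes the empty word keep both completions, [[::]] and [[:: 1]]. *)
Lemma last_completionsP (u l : seq nat) : over_alphabet u ->
  (l \in last_completions u) = over_alphabet l && (discard_last1 l == u).
Proof.
have arc (s : seq nat) (z : nat) :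
    over_alphabet (rcons s z) = (z \in alphabet) && over_alphabet s.
  by rewrite /over_alphabet all_rcons.
rewrite /last_completions => uA; apply/idP/andP => [|[lA /eqP]].
  case: ifPn => u1; rewrite ?mem_seq1 ?mem_seq2.
    by move=> /eqP ->; rewrite arc uA discard_last1_rcons.
  case/pred2P => ->; last by rewrite arc uA discard_last1_rcons.
  split=> //; case/lastP: u u1 {uA} => // s z; rewrite last_rcons => /negPf z1.
  by rewrite discard_last1_rcons z1.
case/lastP: l lA => [_ <-//|s z]; rewrite arc discard_last1_rcons.
case/andP => /alphabetP[] -> _ /= <-.
  by case: ifP; rewrite ?mem_seq1 ?mem_seq2 ?eqxx ?orbT.
by rewrite last_rcons mem_seq2 eqxx.
Qed.

Lemma mem_primitives (u w : seq nat) : over_alphabet u ->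
  (w \in primitives u) =
    [&& Defs.differentiable w, head 1 (run_lengths w) == 1 & derivative w == u].
Proof.
move=> uA; rewrite !mem_cat; case: w => [|a w].
  rewrite /= mem_nseq eqxx andbT eq_sym.
  have nmap (x : nat) (f : seq nat -> seq nat) (s : seq (seq nat)) :
      ([::] \in [seq x :: f l | l <- s]) = false.
    by apply/negP => /mapP[].
  by rewrite !nmap !orbF; case: (_ == _).
have -> : (a :: w \in nseq (u == [::]) [::]) = false by rewrite mem_nseq; case: (_ == _).
rewrite /=; apply/orP/and3P => [|[dw]].
  have main (x : nat) l : x \in alphabet -> l \in last_completions u ->
      a :: w = x :: word_of_runs (swap x) l ->
      [/\ Defs.differentiable (a :: w), head 1 (run_lengths (a :: w)) == 1
        & derivative (a :: w) == u].
    move=> xA; rewrite last_completionsP // => /andP[lA lu] aw.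
    have awE : a :: w = word_of_runs x (1 :: l) by [].
    have l1A : over_alphabet (1 :: l) by [].
    have l0 : all (ltn 0) (1 :: l) by apply: sub_all l1A => -[].
    rewrite awE differentiableE derivativeE run_lengths_word_of_runs //.
    by rewrite over_alphabet_word_of_runs // l1A.
  by case=> /mapP[l lu]; apply: main.
have := dw; rewrite differentiableE => /andP[wA].
have := word_of_runs_run_lengths wA; rewrite derivativeE.
case: (run_lengths (a :: w)) => [//|k l] + + /= k1; rewrite (eqP k1) /= => -[<-] lA lu.
have lc : l \in last_completions u by rewrite last_completionsP // lA.
by case/andP: wA => /alphabetP[] -> _; [left|right]; apply: map_f.
Qed.

Lemma word_of_runs_inj (x : nat) (l l' : seq nat) : x \in alphabet ->
  all (ltn 0) l -> all (ltn 0) l' -> word_of_runs x l = word_of_runs x l' -> l = l'.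
Proof.
by move=> xA l0 l0' /(congr1 run_lengths); rewrite !run_lengths_word_of_runs.
Qed.

Lemma primitives_uniq (u : seq nat) : over_alphabet u -> uniq (primitives u).
Proof.
move=> uA; have cU : uniq (last_completions u).
  rewrite /last_completions; case: ifP => // _ /=; rewrite mem_seq1 andbT.
  by apply/eqP => /(congr1 size); rewrite size_rcons; lia.
have mU (x y : nat) : y \in alphabet ->
    uniq [seq x :: word_of_runs y l | l <- last_completions u].
  move=> yA; rewrite map_inj_in_uniq // => l l'.
  rewrite !last_completionsP // => /andP[lA _] /andP[lA' _] [].
  by apply: word_of_runs_inj => //; [apply: sub_all lA|apply: sub_all lA'] => -[].
rewrite /primitives !cat_uniq !mU // !andbT.
apply/and3P; split; first by case: (_ == _).
  apply/hasPn => w; rewrite mem_cat mem_nseq => /orP[] /mapP[l _ ->];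
  by rewrite andbF.
by apply/hasPn => w /mapP[l _ ->]; apply/mapP => -[].
Qed.

(** Runs alternate, so parity decides. The default [swap x] is the letter that [primitives] puts in
    front, which covers the empty list too. *)
Lemma last_word_of_runs (x : nat) (l : seq nat) : all (ltn 0) l -> 
  last (swap x) (word_of_runs x l) = if odd (size l) then x else swap x.
Proof.
elim: l x => //= k l IH x /andP[k0 /IH IHl].
have {}IHl := IHl (swap x); rewrite swapK in IHl.
rewrite last_cat; case: k k0 => // k _.
have -> : last (swap x) (nseq k.+1 x) = x.
  by rewrite /=; elim: k => //= k ->.
by rewrite IHl; case: (odd _).
Qed.

(** The default 0 is not a letter, so the empty word is counted for neither letter. *)
Definition ending (x : nat) (M : seq (seq nat)) : nat :=
  count (fun w => last 0 w == x) M.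

(* Of the primitives of [u], those starting with 1 and those starting with 2 are
   exchanged by swapping letters, so each letter ends half of them. *)
Lemma ending_primitives (x : nat) (u : seq nat) : x \in alphabet -> over_alphabet u ->
  ending x (primitives u) = (last 2 u == 2).+1.
Proof.
move=> xA uA; rewrite /ending /primitives !count_cat !count_map.
have -> : count (fun w => last 0 w == x) (nseq (u == [::]) [::]) = 0.
  by rewrite count_nseq; case/alphabetP: xA => ->.
have u0 : all (ltn 0) u by apply: sub_all uA => -[].
have ru0 : all (ltn 0) (rcons u 1) by rewrite all_rcons.
have u2 : last 2 u = 1 \/ last 2 u = 2.
  apply: alphabetP; case/lastP: u uA {u0 ru0} => // s z.
  by rewrite last_rcons /over_alphabet all_rcons => /andP[].
have e1 := fun l => @last_word_of_runs 1 l; have e2 := fun l => @last_word_of_runs 2 l.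
rewrite /last_completions; case: u2 => -> /=; rewrite ?e1 ?e2 // !size_rcons /=;
by case/alphabetP: xA => ->; case: (odd _).
Qed.

(** * Counting LDE words by height *)

Fixpoint lde_words (K : nat) : seq (seq nat) :=
  if K is K'.+1 then flatten (map primitives (lde_words K')) else [:: [::]].

Lemma smooth_over_alphabet (w : seq nat) : `[< Defs.smooth w >] -> over_alphabet w.
Proof. by rewrite smoothE differentiableE => /andP[/andP[]]. Qed.

(** Heights below [K] are included, because [[::]] is among its own primitives. *)
Lemma mem_lde_words (K : nat) (w : seq nat) :
  (w \in lde_words K) = left_doubly_extendable w && (iter K derivative w == [::]).
Proof.
elim: K w => [|K IH] w.
  by rewrite mem_seq1 /= andbC; case: eqP => //= ->; rewrite left_doubly_extendable_nil.
rewrite iterSr; apply/flatten_mapP/andP => [[u]|[ldw Kw]].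
  rewrite IH => /andP[ldu Ku]; rewrite mem_primitives; last first.
    exact/smooth_over_alphabet/left_doubly_extendable_smooth.
  by case/and3P=> dw w1 /eqP wu; rewrite left_doubly_extendableE // w1 wu.
have /[dup] := left_doubly_extendable_smooth ldw; rewrite smoothE => /andP[dw sw] _.
move: ldw; rewrite left_doubly_extendableE // => /andP[w1 ldu].
exists (derivative w); first by rewrite IH ldu.
by rewrite mem_primitives ?dw ?w1 ?eqxx //; apply: over_alphabet_derivative.
Qed.

Lemma lde_words_over_alphabet (K : nat) (w : seq nat) :
  w \in lde_words K -> over_alphabet w.
Proof.
by rewrite mem_lde_words => /andP[/left_doubly_extendable_smooth/smooth_over_alphabet].
Qed.

(** The map [g] recovers the block of an element, so distinct blocks are disjoint; for primitives,
    [g] is the derivative. *)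
Lemma uniq_flatten_map (T S : eqType) (F : T -> seq S) (g : S -> T) (s : seq T) :
  uniq s -> {in s, forall u, uniq (F u)} ->
  {in s, forall u w, w \in F u -> g w = u} -> uniq (flatten (map F s)).
Proof.
elim: s => //= u s IH /andP[us sU] FU Fg.
rewrite cat_uniq FU ?mem_head //= IH //.
- rewrite andbT; apply/hasPn => w /flatten_mapP[v vs wv].
  apply: contra us => wu; rewrite -(Fg _ (mem_head _ _) _ wu).
  by rewrite (Fg v _ w wv) // in_cons vs orbT.
- by move=> v vs; apply: FU; rewrite in_cons vs orbT.
- by move=> v vs; apply: Fg; rewrite in_cons vs orbT.
Qed.

Lemma lde_words_uniq (K : nat) : uniq (lde_words K).
Proof.
elim: K => //= K IH; apply: (@uniq_flatten_map _ _ _ derivative) => //.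
- by move=> u /lde_words_over_alphabet; apply: primitives_uniq.
- by move=> u /lde_words_over_alphabet uA w; rewrite mem_primitives // => /and3P[_ _ /eqP].
Qed.

Lemma size_ending (s : seq (seq nat)) : all over_alphabet s ->
  size s = ending 1 s + ending 2 s + count_mem [::] s.
Proof.
rewrite /ending; elim: s => //= w s IH /andP[wA /IH ->].
case/lastP: w wA => [|w z]; first by move=> _ /=; lia.
rewrite /over_alphabet all_rcons last_rcons => /andP[zA _].
have -> : (rcons w z == [::]) = false by case: w.
by case/alphabetP: zA => ->; rewrite /=; lia.
Qed.

Lemma count_last2 (s : seq (seq nat)) :
  count (fun w => last 2 w == 2) s = ending 2 s + count_mem [::] s.
Proof. by rewrite /ending; elim: s => //= -[|a w] s -> /=; lia. Qed.

Lemma count_mem_nil_lde_words (K : nat) : count_mem [::] (lde_words K) = 1.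
Proof.
rewrite count_uniq_mem ?lde_words_uniq // mem_lde_words left_doubly_extendable_nil.
by have -> : iter K derivative [::] = [::] by elim: K => //= K ->.
Qed.

Lemma all_lde_words (K : nat) : all over_alphabet (lde_words K).
Proof. by apply/allP => w; apply: lde_words_over_alphabet. Qed.

(** Let e words end in each letter. Every one of the 2e + 1 words has one primitive ending in [x],
    and the e + 1 words that end in 2 or are empty have one more. So e becomes 3e + 2, and e + 1
    triples. *)
Lemma ending_lde_words (K : nat) (x : nat) : x \in alphabet ->
  (ending x (lde_words K)).+1 = 3 ^ K.
Proof.
elim: K x => [|K IH] x xA; first by case/alphabetP: xA => ->.
rewrite /= /ending count_flatten -map_comp.
have -> : sumn [seq (count (fun w => last 0 w == x) \o primitives) u | u <- lde_words K] =
    sumn [seq (last 2 u == 2).+1 | u <- lde_words K].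
  congr sumn; apply/eq_in_map => u uK; apply: ending_primitives => //.
  exact: lde_words_over_alphabet uK.
have -> : sumn [seq (last 2 u == 2).+1 | u <- lde_words K] =
    size (lde_words K) + count (fun u => last 2 u == 2) (lde_words K).
  by elim: (lde_words K) => //= u s ->; lia.
rewrite (size_ending (all_lde_words K)) count_last2 count_mem_nil_lde_words.
by have := IH 1 isT; have := IH 2 isT; rewrite expnS; lia.
Qed.

Lemma size_lde_words (K : nat) : (size (lde_words K)).+1 = 2 * 3 ^ K.
Proof.
rewrite (size_ending (all_lde_words K)) count_mem_nil_lde_words.
by have := @ending_lde_words K 1 isT; have := @ending_lde_words K 2 isT; lia.
Qed.

(** * Enumeration of smooth words and the formula for [gamma] *)

Fixpoint smooth_words (n : nat) : seq (seq nat) :=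
  if n is n'.+1 then
    [seq 1 :: w | w <- smooth_words n' & `[< Defs.smooth (1 :: w) >]] ++
    [seq 2 :: w | w <- smooth_words n' & `[< Defs.smooth (2 :: w) >]]
  else [:: [::]].

Lemma mem_smooth_words (n : nat) (w : seq nat) :
  (w \in smooth_words n) = (size w == n) && `[< Defs.smooth w >].
Proof.
elim: n w => [|n IH] w.
  by rewrite mem_seq1; case: w => [|x w] //=; rewrite smooth_nil.
rewrite mem_cat; apply/orP/andP => [[] /mapP[v]|].
- by rewrite mem_filter IH => /and3P[sv /eqP <- _] ->.
- by rewrite mem_filter IH => /and3P[sv /eqP <- _] ->.
case: w => [[]//|x w] [/eqP[wn] sxw].
have xA : x \in alphabet by case/andP: (smooth_over_alphabet sxw).
have main : w \in [seq v <- smooth_words n | `[< Defs.smooth (x :: v) >]].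
  by rewrite mem_filter sxw IH wn eqxx (smooth_behead sxw).
by case/alphabetP: xA main => -> main; [left|right]; apply: map_f.
Qed.

Lemma smooth_words_uniq (n : nat) : uniq (smooth_words n).
Proof.
elim: n => //= n IH; rewrite cat_uniq !map_inj_uniq ?filter_uniq //; try by move=> ? ? [].
by rewrite andbT; apply/hasPn => w /mapP[v _ ->]; apply/mapP => -[].
Qed.

Lemma gamma_size (n : nat) : Defs.gamma n = size (smooth_words n).
Proof.
pose word (t : n.-tuple (seq_sub alphabet)) : seq nat := map val t.
have word_inj : injective word by move=> s t /(inj_map val_inj)/val_inj.
pose A := [set t : n.-tuple (seq_sub alphabet) | `[< Defs.smooth (word t) >]]%SET.
rewrite /Defs.gamma -[LHS]/(#|A|) cardE -(size_map word); apply/perm_size/uniq_perm.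
- by rewrite map_inj_uniq ?enum_uniq.
- exact: smooth_words_uniq.
move=> w; rewrite mem_smooth_words; apply/mapP/andP => [[t]|[/eqP wn sw]].
  by rewrite mem_enum finset.inE => st ->; rewrite size_map size_tuple.
(* The letters of a smooth word lie in the alphabet, so it lifts to the finite type of letters. *)
have [s sE] : exists s : seq (seq_sub alphabet), map val s = w.
  have := smooth_over_alphabet sw; elim: w {wn sw} => [_|x w IH /andP[xA /IH[s <-]]].
    by exists [::].
  by exists (SeqSub xA :: s).
have ns : size s == n by rewrite -wn -sE size_map.
by exists (Tuple ns); rewrite ?mem_enum ?finset.inE /word /= sE.
Qed.

Fixpoint lde_shorter (n : nat) : seq (seq nat) :=
  if n is n'.+1 then lde_shorter n' ++ [seq w <- smooth_words n' | left_doubly_extendable w]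
  else [::].

Lemma mem_lde_shorter (n : nat) (w : seq nat) :
  (w \in lde_shorter n) = (size w < n) && left_doubly_extendable w.
Proof.
elim: n => // n IH; rewrite mem_cat mem_filter IH mem_smooth_words ltnS.
rewrite [size w <= n]leq_eqVlt orbC.
case lw: (left_doubly_extendable w) => /=; last by rewrite !andbF.
by rewrite left_doubly_extendable_smooth // !andbT.
Qed.

Lemma lde_shorter_uniq (n : nat) : uniq (lde_shorter n).
Proof.
elim: n => //= n IH; rewrite cat_uniq IH filter_uniq ?smooth_words_uniq // andbT.
apply/hasPn => w; rewrite mem_filter mem_smooth_words => /andP[_ /andP[/eqP wn _]].
by rewrite mem_lde_shorter wn ltnn.
Qed.

(** By inclusion-exclusion over the two prefixed letters, [gamma] grows from [n] to [n.+1] by the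
    number of LDE words of length [n], as every smooth word has at least one extension. *)
Lemma gammaE (n : nat) : Defs.gamma n = (size (lde_shorter n)).+1.
Proof.
rewrite gamma_size; elim: n => //= n IH.
rewrite !size_cat -addSn -IH !size_map !size_filter -count_predUI; congr (_ + _).
rewrite -[RHS]count_predT; apply: eq_in_count => w.
by rewrite mem_smooth_words => /andP[_ /smooth_extendable].
Qed.

Lemma gamma_le (n K : nat) :
  (forall w, left_doubly_extendable w -> size w < n -> iter K derivative w = [::]) ->
  Defs.gamma n <= 2 * 3 ^ K.
Proof.
move=> h; rewrite gammaE -size_lde_words ltnS.
apply: uniq_leq_size (lde_shorter_uniq n) _ => w.
by rewrite mem_lde_shorter mem_lde_words => /andP[wn lw]; rewrite lw h ?eqxx.
Qed.

Lemma gamma_ge (n K : nat) :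
  (forall w, left_doubly_extendable w -> iter K derivative w = [::] -> size w < n) ->
  2 * 3 ^ K <= Defs.gamma n.
Proof.
move=> h; rewrite gammaE -size_lde_words ltnS.
apply: uniq_leq_size (lde_words_uniq K) _ => w.
by rewrite mem_lde_shorter mem_lde_words => /andP[lw /eqP Kw]; rewrite lw h.
Qed.

Lemma smooth_long (n : nat) : exists2 w, Defs.smooth w & size w = n.
Proof.
elim: n => [|n [w /asboolP sw wn]]; first by exists [::] => //; apply/asboolP/smooth_nil.
by case/orP: (smooth_extendable sw) => /asboolP s; eexists; try exact: s; rewrite /= wn.
Qed.

Lemma size_count (w : seq nat) : over_alphabet w ->
  size w = count_mem 1 w + count_mem 2 w.
Proof. by elim: w => //= x w IH /andP[/alphabetP[]-> /IH ->]; rewrite /=; lia. Qed.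

Lemma sumn_count (w : seq nat) : over_alphabet w ->
  sumn w = size w + count_mem 2 w.
Proof. by elim: w => //= x w IH /andP[/alphabetP[]-> /IH ->]; rewrite /=; lia. Qed.

Lemma smooth_derivative (w : seq nat) : Defs.smooth w -> Defs.smooth (derivative w).
Proof. by move=> /asboolP; rewrite smoothE => /andP[_ /asboolP]. Qed.

Lemma count_mem2_swap (w : seq nat) : count_mem 2 (map swap w) = count_mem 1 w.
Proof. by rewrite count_map; apply: eq_count => -[|[|[|x]]]. Qed.

Local Open Scope ring_scope.

(** Both sides are the exponential of [ln a * ln x / ln s]. This turns a power of n into a power of
    3 whose exponent is a logarithm of n. *)
Lemma powR_ln_div (R : realType) (a x s : R) : 0 < a -> 0 < x ->
  x `^ (ln a / ln s) = a `^ (ln x / ln s).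
Proof.
by move=> a0 x0; rewrite /powR !gt_eqF //; congr expR; ring.
Qed.

(** * Growth of lengths under the density hypothesis *)

Section Density.
Variables (R : realType) (theta : R) (n0 : nat).
Hypothesis theta_gt0 : 0 < theta.
Hypothesis dens : forall u : seq nat, Defs.smooth u -> (n0 < size u)%N ->
  theta < (count_mem 2%N u)%:R / (size u)%:R.

Lemma density2 (u : seq nat) : Defs.smooth u -> (n0 < size u)%N ->
  theta * (size u)%:R < (count_mem 2%N u)%:R.
Proof.
move=> su un; have := dens su un; rewrite ltr_pdivlMr // ltr0n.
exact: leq_ltn_trans un.
Qed.

Lemma density1 (u : seq nat) : Defs.smooth u -> (n0 < size u)%N ->
  theta * (size u)%:R < (count_mem 1%N u)%:R.
Proof.
move=> /asboolP; rewrite -smooth_swap -(size_map swap) -count_mem2_swap => /asboolP.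
exact: density2.
Qed.

(** In a smooth word longer than [n0] both letters have density above [theta], and the densities add
    up to 1. *)
Lemma theta_lt_half : theta < 2^-1.
Proof.
have [w sw wn] := smooth_long n0.+1.
have wA : over_alphabet w by apply: smooth_over_alphabet; apply/asboolP.
have := density1 sw; have := density2 sw; rewrite wn ltnSn => /(_ isT) h2 /(_ isT) h1.
have := size_count wA; rewrite wn => /(congr1 (fun k => k%:R : R)); rewrite natrD => e.
have n_gt0 : (0 : R) < n0.+1%:R by rewrite ltr0n.
rewrite -(ltr_pM2r n_gt0); lra.
Qed.

(** One derivation gives |w| <= (2 - theta)|u| + B with B = 2 n0 + 2. Adding 2B to both sides
    absorbs the error, since 3B <= 2B(2 - theta) for theta < 1/2. *)
Lemma smooth_size_le (K : nat) (w : seq nat) : Defs.smooth w ->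
  iter K derivative w = [::] ->
  (size w)%:R + 2 * (2 * n0 + 2)%:R <= 2 * (2 * n0 + 2)%:R * (2 - theta) ^+ K.
Proof.
elim: K w => [|K IH] w sw; first by move=> /= ->; rewrite expr0 mulr1 add0r.
rewrite iterSr => Kw; set u := derivative w.
have su : Defs.smooth u by apply: smooth_derivative.
have {}IH := IH u su Kw.
have uA : over_alphabet u by apply: smooth_over_alphabet; apply/asboolP.
have /andP[_] := sumn_derivative w; rewrite -/u sumn_count // => wu.
have ucount := size_count uA.
have th2 := theta_lt_half; set B := (2 * n0 + 2)%:R in IH *.
have B0 : (0 : R) <= B by apply: ler0n.
(* For long [u], the density of 1 bounds the number of 2s by (1 - theta)|u|; for short [u], |w| <=
   2|u| + 2 <= B. *)
have wB : (size w)%:R <= (2 - theta) * (size u)%:R + B.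
  have [un|un] := ltnP n0 (size u).
    have d1 := density1 su un.
    have w2 : (size w)%:R <= (size u)%:R + (count_mem 2 u)%:R + 2 :> R.
      by rewrite -!natrD ler_nat addn2.
    have B2 : 2 <= B by rewrite (ler_nat _ 2) leq_addl.
    have uE : (size u)%:R = (count_mem 1 u)%:R + (count_mem 2 u)%:R :> R.
      by rewrite -natrD -ucount.
    lra.
  have : (size w)%:R <= B by rewrite ler_nat; lia.
  have : 0 <= (2 - theta) * (size u)%:R by rewrite mulr_ge0 ?ler0n //; lra.
  lra.
rewrite exprS.
have -> : 2 * B * ((2 - theta) * (2 - theta) ^+ K) =
    (2 - theta) * (2 * B * (2 - theta) ^+ K) by ring.
have r0 : 0 <= 2 - theta by lra.
apply: le_trans (ler_wpM2l r0 IH); nra.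
Qed.

(** While the derivative is longer than [n0], a derivation divides the length by at least 1 + theta.
    The factor [(1 + theta) ^+ n0] pays for the remaining derivations, each of which loses a
    letter. *)
Lemma smooth_size_ge (K : nat) (w : seq nat) : Defs.smooth w ->
  iter K derivative w != [::] ->
  (1 + theta) ^+ K <= (size w)%:R * (1 + theta) ^+ n0.
Proof.
have s1 : 1 <= 1 + theta by rewrite lerDl ltW.
have size_iter (k : nat) (v : seq nat) : iter k derivative v != [::] -> (k < size v)%N.
  elim: k v => [|k IH] v; first by case: v.
  rewrite iterSr => /IH kv; apply: (leq_ltn_trans kv (size_derivative _)).
  by apply: contraTneq kv => ->.
elim: K w => [|K IH] w sw.
  move=> /size_iter w0; rewrite expr0; apply: mulr_ege1; last exact: exprn_ege1.
  by rewrite ler1n.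
move=> Kw; have := size_iter _ _ Kw; move: Kw; rewrite iterSr; set u := derivative w => Ku wK.
have uK := size_iter _ _ Ku.
have su : Defs.smooth u by apply: smooth_derivative.
have uA : over_alphabet u by apply: smooth_over_alphabet; apply/asboolP.
have [un|un] := ltnP n0 (size u); last first.
  (* Here [K < size u <= n0], so [K.+1 <= n0]. *)
  apply: (@le_trans _ _ (1 * (1 + theta) ^+ n0)).
    by rewrite mul1r ler_weXn2l //; lia.
  by rewrite ler_wpM2r ?exprn_ge0 ?ler1n ?(le_trans ler01) //; lia.
rewrite exprS; apply: (@le_trans _ _ ((1 + theta) * ((size u)%:R * (1 + theta) ^+ n0))).
  by rewrite ler_wpM2l ?IH //; lra.
rewrite mulrA ler_wpM2r ?exprn_ge0 ?(le_trans ler01) //.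
have /andP[+ _] := sumn_derivative w; rewrite -/u sumn_count // -(ler_nat R) natrD.
have := density2 su un; lra.
Qed.

(** * The two bounds on [gamma] *)

Lemma gamma_upper (n : nat) : (0 < n)%N ->
  (Defs.gamma n)%:R <= 2 * 3 ^+ n0.+1 * n%:R `^ (ln 3 / ln (1 + theta)) :> R.
Proof.
move=> n_gt0; have n_gt0R : (0 : R) < n%:R by rewrite ltr0n.
rewrite powR_ln_div //; set s := 1 + theta.
have s1 : 1 < s by rewrite ltrDl.
have lns : 0 < ln s by rewrite ln_gt0.
set y := ln n%:R / ln s.
have y0 : 0 <= y by rewrite divr_ge0 ?ln_ge0 ?ler1n // ltW.
have /andP[yl yu] := truncn_itv y0; set k := Num.truncn y in yl yu.
have s0 : 0 < s by lra.
have sy : s `^ y = n%:R.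
  by rewrite /powR gt_eqF // /y divfK ?gt_eqF // lnK.
have nK : n%:R < s ^+ k.+1.
  by rewrite -sy -powR_mulrn ?ltW // /powR gt_eqF // ltr_expR ltr_pM2r.
(* An LDE word surviving [n0.+1 + k] derivations has length at least [s ^+ k.+1], which exceeds
   [n]. *)
apply: (@le_trans _ _ (2 * 3 ^ (n0.+1 + k))%:R).
  rewrite ler_nat; apply: gamma_le => w lw wn; apply/eqP; apply: contraTT wn => Kw.
  have sw : Defs.smooth w by apply/asboolP/left_doubly_extendable_smooth.
  have := smooth_size_ge sw Kw; rewrite -/s addSnnS exprD mulrC ler_pM2r ?exprn_gt0 //.
  by move=> /(lt_le_trans nK); rewrite ltr_nat => /ltnW; rewrite leqNgt.
rewrite natrM natrX exprD mulrA ler_pM2l ?mulr_gt0 ?exprn_gt0 //.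
by rewrite -powR_mulrn // ler_powR // ler1n.
Qed.

Lemma gamma_lower (n : nat) : (0 < n)%N ->
  ((2 * (2 * n0 + 2)%:R) `^ (ln 3 / ln (2 - theta)) * 3)^-1 *
    n%:R `^ (ln 3 / ln (2 - theta)) <= (Defs.gamma n)%:R :> R.
Proof.
move=> n_gt0; have n_gt0R : (0 : R) < n%:R by rewrite ltr0n.
set r := 2 - theta; set C := 2 * (2 * n0 + 2)%:R; have th2 := theta_lt_half.
have C0 : 0 < C by rewrite mulr_gt0 // ltr0n addn2.
have r1 : 1 < r by rewrite /r; lra.
have lnr : 0 < ln r by rewrite ln_gt0.
have r0 : 0 < r by lra.
(* [C] is the constant of [smooth_size_le]: words emptied by k derivations are shorter than
   [C * r ^+ k], so k is taken as the integer part of the logarithm of n / C. The factor 3 pays for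
   the rounding. *)
set e := ln 3 / ln r; set y := ln (n%:R / C) / ln r.
have -> : (C `^ e * 3)^-1 * n%:R `^ e = 3 `^ y / 3.
  rewrite /y -(@powR_ln_div _ 3 (n%:R / C)) ?divr_gt0 // -/e (@powRM _ n%:R) ?invr_ge0 ?ltW //.
  have -> : C^-1 `^ e = (C `^ e)^-1.
    apply: (mulfI (lt0r_neq0 (powR_gt0 e C0))).
    by rewrite -(@powRM _ C) ?invr_ge0 ?ltW // !mulfV ?powR1 ?gt_eqF ?powR_gt0.
  by rewrite invfM; ring.
have gamma1 : 1 <= (Defs.gamma n)%:R :> R by rewrite ler1n gammaE.
rewrite ler_pdivrMr //.
have [y0|y0] := leP 0 y; last first.
  have : 3 `^ y <= 3 `^ 0 :> R by rewrite ler_powR ?ler1n // ltW.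
  rewrite powRr0; lra.
have /andP[yl yu] := truncn_itv y0; set k := Num.truncn y in yl yu.
have ry : r `^ y = n%:R / C.
  by rewrite /powR gt_eqF // /y divfK ?gt_eqF // lnK // posrE divr_gt0.
have rk : C * r ^+ k <= n%:R.
  rewrite mulrC -ler_pdivlMr // -ry -(powR_mulrn _ (ltW r0)).
  by apply: ler_powR => //; apply: ltW.
apply: (@le_trans _ _ (3 `^ k.+1%:R)); first by rewrite ler_powR ?ler1n // ltW.
rewrite powR_mulrn // exprS mulrC ler_pM2r //.
apply: (@le_trans _ _ (2 * 3 ^ k)%:R).
  by rewrite natrM natrX ler_peMl ?exprn_ge0 ?ler1n.
rewrite ler_nat; apply: gamma_ge => w lw Kw.
have sw : Defs.smooth w by apply/asboolP/left_doubly_extendable_smooth.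
rewrite -(ltr_nat R); apply: lt_le_trans rk.
by apply: lt_le_trans (smooth_size_le sw Kw); rewrite ltrDl.
Qed.

End Density.

Theorem theorem7 (R : realType) (theta : R) (n0 : nat)
  (theta_gt0 : 0 < theta) (n0_gt0 : (0 < n0)%N)
  (dens : forall u : seq nat, Defs.smooth u -> (n0 < size u)%N ->
     theta < (count_mem 2%N u)%:R / (size u)%:R) :
  exists c1 c2 : R, [/\ 0 < c1, 0 < c2 &
    forall n : nat, (0 < n)%N ->
      c1 * n%:R `^ (ln 3 / ln (2 - theta)) <= (Defs.gamma n)%:R
      /\ (Defs.gamma n)%:R <= c2 * n%:R `^ (ln 3 / ln (1 + theta))].
Proof.
exists ((2 * (2 * n0 + 2)%:R) `^ (ln 3 / ln (2 - theta)) * 3)^-1, (2 * 3 ^+ n0.+1).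
split=> [||n n_gt0].
- by rewrite invr_gt0 mulr_gt0 // powR_gt0 // mulr_gt0 // ltr0n addn2.
- by rewrite mulr_gt0 // exprn_gt0.
- by split; [apply: gamma_lower|apply: gamma_upper].
Qed.
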